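(* Let $P_F$ denote the joint distribution, in a population of healthcare-seeking individuals, of the random variables $(A, Y, W, D, S, \Delta, X)$, where $A\in\{0,1\}$ is a binary exposure (vaccination status or dichotomized immune marker level at the time of potential SARS-CoV-2 exposure), $Y\in\{0,1\}$ indicates SARS-CoV-2 infection, $W\in\{0,1\}$ indicates a cause other than SARS-CoV-2 that could induce symptoms, $D\in\{0,1\}$ indicates meeting the symptom definition, $S\in\{0,1\}$ indicates obtaining SARS-CoV-2 testing, $\Delta\in\{0,1\}$ indicates that the exposure is observed, and $X\in\mathbb{R}^r$ are covariates. For $a\in\{0,1\}$ let $Y(a), D(a)$ be the potential outcomes of infection and of meeting the symptom definition under exposure $a$, and let $P_{F,ca}$ be the joint distribution of $(A,Y,W,D,X,Y(0),Y(1),D(0),D(1))$ (whose marginal on the observed full-data variables agrees with $P_F$). Let $P$ denote the distribution of the data as recorded in the test-negative design (TND) study, and define $$\mu_P(y,x) := P(A=1\mid D=1,S=1,\Delta=1,Y=y,X=x),\qquad OR(P)(x):=\frac{\mu_P(1,x)/(1-\mu_P(1,x))}{\mu_P(0,x)/(1-\mu_P(0,x))}.$$ Assume: (1) $P\big(P(Y=1,D=1\mid S=1,X)>0\big)=1$ and $P\big(P(Y=0,D=1\mid S=1,X)>0\big)=1$; (2) $P\big(P(\Delta=1\mid D=1,S=1,Y,X)>0\big)=1$; (3) $P_F\big(P_F(S=1\mid D=1,Y,X)>0\big)=1$; (4) $S\perp\!\!\!\perp A\mid D=1,Y,X$; (5) $\Delta\perp\!\!\!\perp A\mid D=1,S=1,Y,X$;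 (6) $P_F(Y=0,D=1\mid A=1,X)=P_F(Y=0,D=1\mid A=0,X)$; (7) the exposure status recorded at SARS-CoV-2 testing accurately reflects the exposure status $A$ at the time of potential SARS-CoV-2 exposure in TND participants; (8) the SARS-CoV-2 test result accurately measures the infection status $Y$ in TND participants; (9) (consistency) the conditional distribution of $(Y(a),D(a))$ given $A=a$ equals that of $(Y,D)$ given $A=a$, for $a\in\{0,1\}$; (10) (no interference) $(Y_i(a),D_i(a))\perp\!\!\!\perp A_k$ for $a\in\{0,1\}$ and all pairs of distinct individuals $i\neq k$; (11) (no unmeasured confounding) $(Y(a),D(a))\perp\!\!\!\perp A\mid X$ for $a\in\{0,1\}$. Then $$OR(P)(x)=RR(P_{F,ca})(x):=\frac{P_{F,ca}(Y(1)=1,D(1)=1\mid X=x)}{P_{F,ca}(Y(0)=1,D(0)=1\mid X=x)}.$$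
   Context: Test-negative design: individuals are enrolled if they meet the symptom definition ($D=1$) and obtain SARS-CoV-2 testing ($S=1$); cases test positive ($Y=1$) and noncases test negative ($Y=0$). The exposure $A$ is observed only for participants with $\Delta=1$. $P_F$ is the full-data distribution over the healthcare-seeking population, $P_{F,ca}$ its extension including potential outcomes, and $P$ the distribution of the observed TND data.
   Formalization: Consistency (9) is conditional on X: given A=a and X=x, (Y(a),D(a)) has the same law as (Y,D), for almost every x; also $P_F(A=a|X=x)>0$ for both a and almost every x. The statement above fails without it. *)

(* Defs.v *)
From HB Require Import structures.
From mathcomp Require Import all_boot all_order all_algebra.
From mathcomp Require Import all_classical all_reals all_analysis.
Set Implicit Arguments. Unset Strict Implicit. Unset Printing Implicit Defensive.
Import Order.TTheory GRing.Theory Num.Theory.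
Local Open Scope ring_scope.

(* One individual of the healthcare-seeking population is described by
   the covariate X in R^r (represented as r.-tuple R, with the product Borel
   sigma-algebra) together with twelve binary variables, collected in an
   outcome [w : outcome] :
     A, Y, W, D, S, Delta                 (full data, law P_F),
     Arec, Yrec                           (exposure / infection as recorded in
                                           the TND data, law P),
     Y(0), Y(1), D(0), D(1)               (potential outcomes, law P_{F,ca}).
   The joint law of all these variables is given by its disintegration along X:
   the law [mu] of X and, for every x, the conditional probability mass
   function [q x] of the binary variables given X = x.  All probabilities
   "given X = x" below are probabilities under [q x]. *)

Definition outcome := {ffun 'I_12 -> bool}.

Definition vA     : 'I_12 := @Ordinal 12 0 isT.
Definition vY     : 'I_12 := @Ordinal 12 1 isT.
Definition vW     : 'I_12 := @Ordinal 12 2 isT.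
Definition vD     : 'I_12 := @Ordinal 12 3 isT.
Definition vS     : 'I_12 := @Ordinal 12 4 isT.
Definition vDelta : 'I_12 := @Ordinal 12 5 isT.
Definition vArec  : 'I_12 := @Ordinal 12 6 isT.
Definition vYrec  : 'I_12 := @Ordinal 12 7 isT.
Definition vY0    : 'I_12 := @Ordinal 12 8 isT.
Definition vY1    : 'I_12 := @Ordinal 12 9 isT.
Definition vD0    : 'I_12 := @Ordinal 12 10 isT.
Definition vD1    : 'I_12 := @Ordinal 12 11 isT.

Definition vYpot (a : bool) : 'I_12 := if a then vY1 else vY0.
Definition vDpot (a : bool) : 'I_12 := if a then vD1 else vD0.

Section Prob.
Variable R : realType.

Definition is_pmf (q : {ffun outcome -> R}) : Prop :=
  (forall w, 0 <= q w) /\ \sum_(w : outcome) q w = 1.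

Definition prob (q : {ffun outcome -> R}) (E : pred outcome) : R :=
  \sum_(w : outcome | E w) q w.

(* elementary conditional probability P(E | F) (= 0 when P(F) = 0) *)
Definition cprob (q : {ffun outcome -> R}) (E F : pred outcome) : R :=
  prob q [pred w : outcome | E w && F w] / prob q F.

Definition cond_indep (T1 T2 : eqType) (q : {ffun outcome -> R})
    (U : outcome -> T1) (V : outcome -> T2) (C : pred outcome) : Prop :=
  forall (u : T1) (v : T2),
    prob q [pred w : outcome | (U w == u) && (V w == v) && C w] * prob q C =
    prob q [pred w : outcome | (U w == u) && C w] * prob q [pred w : outcome | (V w == v) && C w].

(* mu_P(y, x) = P(A = 1 | D = 1, S = 1, Delta = 1, Y = y, X = x), computed in the
   TND data as recorded (recorded exposure and recorded test result) *)
Definition muP (q : {ffun outcome -> R}) (y : bool) : R :=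
  cprob q [pred w : outcome | w vArec]
    [pred w : outcome | [&& w vD, w vS, w vDelta & w vYrec == y]].

Definition ORP (q : {ffun outcome -> R}) : R :=
  (muP q true / (1 - muP q true)) / (muP q false / (1 - muP q false)).

Definition RRca (q : {ffun outcome -> R}) : R :=
  prob q [pred w : outcome | w (vYpot true) && w (vDpot true)] /
  prob q [pred w : outcome | w (vYpot false) && w (vDpot false)].

End Prob.

(* Main.v *)
(* By (7) and (8) the recorded exposure and test result coincide with A and Y
   on the tested population, up to a null event.  The exposure odds among tested
   participants with observed exposure and test result y then reduce, by (5) and
   then (4), to the exposure odds on the event {D = 1, Y = y}.  For y = 0,
   assumption (6) says that the control event is mean independent of A, so those
   odds are the marginal exposure odds; the odds ratio therefore equals
   P(Y = 1, D = 1 | A = 1) / P(Y = 1, D = 1 | A = 0), which is the risk ratio of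
   the potential outcomes by consistency (9) and no unmeasured confounding (11).
   Everything holds pointwise in x, hence almost everywhere. *)

Require Import Defs.
From HB Require Import structures.
From mathcomp Require Import all_boot all_order all_algebra.
From mathcomp Require Import all_classical all_reals all_analysis.
From mathcomp Require Import ring lra.
Import Order.TTheory GRing.Theory Num.Theory.
Local Open Scope ring_scope.

Ltac truth_table :=
  move=> ? /=;
  repeat match goal with |- context [@fun_of_fin _ _ _ ?w ?i] => case: (@fun_of_fin _ _ _ w i) end;
  by [].

Section FiniteProbability.
Variables (R : realType) (q : {ffun outcome -> R}).
Hypothesis hq : is_pmf q.

Definition odds (V C : pred outcome) : R :=
  prob q [pred w | V w && C w] / prob q [pred w | ~~ V w && C w].

Lemma eq_prob (E F : pred outcome) : E =1 F -> prob q E = prob q F.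
Proof. exact: eq_bigl. Qed.

Lemma eq_odds (V C C' : pred outcome) : C =1 C' -> odds V C = odds V C'.
Proof. by move=> hC; rewrite /odds; congr (_ / _); apply: eq_prob => w /=; rewrite hC. Qed.

Lemma eq_cprob (E E' F F' : pred outcome) :
  E =1 E' -> F =1 F' -> cprob q E F = cprob q E' F'.
Proof.
by rewrite /cprob => hE hF; congr (_ * _^-1); apply: eq_prob => w /=; rewrite ?hE ?hF.
Qed.

Lemma eq_prob_mul {E1 E2 E3 E4 F1 F2 F3 F4 : pred outcome} :
  prob q E1 * prob q E2 = prob q E3 * prob q E4 ->
  E1 =1 F1 -> E2 =1 F2 -> E3 =1 F3 -> E4 =1 F4 ->
  prob q F1 * prob q F2 = prob q F3 * prob q F4.
Proof. by move=> h /eq_prob<- /eq_prob<- /eq_prob<- /eq_prob<-. Qed.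

Lemma prob_ge0 (E : pred outcome) : 0 <= prob q E.
Proof. by apply: sumr_ge0 => w _; case: hq. Qed.

Lemma prob_predT : prob q predT = 1.
Proof. by case: hq. Qed.

Lemma prob_split (V E : pred outcome) :
  prob q E = prob q [pred w | V w && E w] + prob q [pred w | ~~ V w && E w].
Proof. by rewrite /prob (bigID V) /=; congr (_ + _); apply: eq_bigl => w; rewrite andbC. Qed.

Lemma le_prob (E F : pred outcome) : subpred E F -> prob q E <= prob q F.
Proof.
move=> hEF; rewrite (prob_split E F) (@eq_prob [pred w | E w && F w] E).
  by rewrite lerDl prob_ge0.
by move=> w /=; case hE: (E w) => //=; apply: hEF.
Qed.

Lemma prob_gt0_cprob {E F : pred outcome} :
  0 < cprob q E F -> 0 < prob q [pred w | E w && F w].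
Proof.
move=> hEF; rewrite lt_def prob_ge0 andbT.
by apply: contraTneq hEF; rewrite /cprob => ->; rewrite mul0r ltxx.
Qed.

Lemma prob_or_eq0 (Z1 Z2 : pred outcome) :
  prob q Z1 = 0 -> prob q Z2 = 0 -> prob q [pred w | Z1 w || Z2 w] = 0.
Proof.
move=> h1 h2; apply/le_anti; rewrite prob_ge0 andbT (prob_split Z1).
rewrite -[0]addr0 -{1}h1 -h2.
by apply: lerD; apply: le_prob => w /=; case: (Z1 w).
Qed.

Lemma eq_prob_null (Z E F : pred outcome) :
  prob q Z = 0 -> (forall w, ~~ Z w -> E w = F w) -> prob q E = prob q F.
Proof.
move=> hZ hEF; rewrite (prob_split Z E) (prob_split Z F).
have null (G : pred outcome) : prob q [pred w | Z w && G w] = 0.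
  by apply/le_anti; rewrite prob_ge0 andbT -hZ; apply: le_prob => w /andP[].
rewrite !null !add0r; apply: eq_prob => w /=.
by case: (boolP (Z w)) => [_|/hEF ->].
Qed.

Lemma odds_eq_null (Z V V' C C' : pred outcome) : prob q Z = 0 ->
  (forall w, ~~ Z w -> C w = C' w) -> (forall w, ~~ Z w -> C w -> V w = V' w) ->
  odds V C = odds V' C'.
Proof.
move=> hZ hC hV; rewrite /odds.
congr (_ * _^-1); apply: eq_prob_null hZ _ => w nZ /=;
  by rewrite -hC //; case Cw: (C w); rewrite ?andbF // !andbT (hV w nZ Cw).
Qed.

(* No positivity is needed: when prob q F = 0 both sides are 0, as x / 0 = 0. *)
Lemma cprob_odds (E F : pred outcome) : cprob q E F / (1 - cprob q E F) = odds E F.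
Proof.
rewrite /cprob /odds (prob_split E F).
set a := prob q [pred w | E w && F w]; set b := prob q [pred w | ~~ E w && F w].
have a0 : 0 <= a := prob_ge0 _; have b0 : 0 <= b := prob_ge0 _.
have [ab0|ab_neq0] := eqVneq (a + b) 0.
  have [-> ->] : a = 0 /\ b = 0 by split; lra.
  by rewrite !mul0r.
rewrite [1 - _](_ : _ = b / (a + b)); last by field.
by rewrite invf_div mulrA divfK.
Qed.

Lemma cond_indep_odds {U V C : pred outcome} :
  cond_indep q U V C -> 0 < prob q [pred w | U w && C w] ->
  odds V [pred w | U w && C w] = odds V C.
Proof.
move=> hUV hUC.
have hC : 0 < prob q C by apply: (lt_le_trans hUC); apply: le_prob => w /andP[].
have e1 : prob q [pred w | V w && (U w && C w)] * prob q C =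
    prob q [pred w | U w && C w] * prob q [pred w | V w && C w].
  by apply: eq_prob_mul (hUV true true) _ _ _ _ => w /=; case: (U w); case: (V w).
have e0 : prob q [pred w | ~~ V w && (U w && C w)] * prob q C =
    prob q [pred w | U w && C w] * prob q [pred w | ~~ V w && C w].
  by apply: eq_prob_mul (hUV true false) _ _ _ _ => w /=; case: (U w); case: (V w).
rewrite /odds -(mulfK (lt0r_neq0 hC) (prob q [pred w | V w && _])) e1.
rewrite -(mulfK (lt0r_neq0 hC) (prob q [pred w | ~~ V w && _])) e0.
set u := prob q [pred w | U w && C w]; set d0 := prob q [pred w | ~~ V w && C w].
have [->|d0_neq0] := eqVneq d0 0; first by rewrite !(mulr0, mul0r, invr0).
by field; rewrite d0_neq0 !lt0r_neq0.
Qed.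

Lemma odds_predT (V : pred outcome) :
  odds V predT = prob q V / prob q [pred w | ~~ V w].
Proof. by rewrite /odds; congr (_ * _^-1); apply: eq_prob => w /=; rewrite andbT. Qed.

Lemma mul_cprob (E F : pred outcome) :
  prob q F != 0 -> cprob q E F * prob q F = prob q [pred w | F w && E w].
Proof. by move=> hF; rewrite /cprob divfK //; apply: eq_prob => w /=; rewrite andbC. Qed.

Lemma odds_cprob (V E : pred outcome) :
  prob q V != 0 -> prob q [pred w | ~~ V w] != 0 ->
  odds V E = cprob q E V / cprob q E [pred w | ~~ V w] * odds V predT.
Proof.
move=> hV hnV; rewrite odds_predT /odds -(mul_cprob E _ hV) -(mul_cprob E _ hnV).
have [->|c0_neq0] := eqVneq (cprob q E [pred w | ~~ V w]) 0.
  by rewrite !(mul0r, invr0, mulr0).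
by field; rewrite c0_neq0 hnV.
Qed.

Lemma indep_cprob {T1 T2 : eqType} {Z : outcome -> T1} {V : outcome -> T2} z v :
  cond_indep q Z V predT -> prob q [pred w | V w == v] != 0 ->
  prob q [pred w | Z w == z] = cprob q [pred w | Z w == z] [pred w | V w == v].
Proof.
move=> hZV hv.
have e : prob q [pred w | (Z w == z) && (V w == v)] * prob q predT =
    prob q [pred w | Z w == z] * prob q [pred w | V w == v].
  by apply: eq_prob_mul (hZV z v) _ _ _ _ => w /=; rewrite ?andbT.
by rewrite prob_predT mulr1 in e; rewrite /cprob /= e mulfK.
Qed.

Lemma odds_mean_indep (V E : pred outcome) :
  prob q V != 0 -> prob q [pred w | ~~ V w] != 0 -> 0 < prob q E ->
  cprob q E V = cprob q E [pred w | ~~ V w] -> odds V E = odds V predT.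
Proof.
move=> hV hnV hE hk; rewrite odds_cprob // hk divff ?mul1r //.
have tot : prob q V + prob q [pred w | ~~ V w] = 1.
  rewrite -prob_predT (prob_split V predT).
  by congr (_ + _); apply: eq_prob => w /=; rewrite andbT.
have -> : cprob q E [pred w | ~~ V w] = prob q E.
  by rewrite (prob_split V E) -(mul_cprob E _ hV) -(mul_cprob E _ hnV) hk -mulrDr tot mulr1.
by rewrite lt0r_neq0.
Qed.

Section TestNegativeDesign.
Hypothesis hA : forall a : bool, 0 < prob q [pred w : outcome | w vA == a].
Hypothesis h1 :
  0 < cprob q [pred w : outcome | w vYrec && w vD] [pred w : outcome | w vS] /\
  0 < cprob q [pred w : outcome | ~~ w vYrec && w vD] [pred w : outcome | w vS].
Hypothesis h2 : forall y : bool,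
  0 < prob q [pred w : outcome | [&& w vD, w vS & w vYrec == y]] ->
  0 < cprob q [pred w : outcome | w vDelta]
              [pred w : outcome | [&& w vD, w vS & w vYrec == y]].
Hypothesis h4 : forall y : bool,
  cond_indep q (fun w => w vS) (fun w => w vA) [pred w : outcome | w vD && (w vY == y)].
Hypothesis h5 : forall y : bool,
  cond_indep q (fun w => w vDelta) (fun w => w vA)
             [pred w : outcome | [&& w vD, w vS & w vY == y]].
Hypothesis h6 :
  cprob q [pred w : outcome | ~~ w vY && w vD] [pred w : outcome | w vA] =
  cprob q [pred w : outcome | ~~ w vY && w vD] [pred w : outcome | ~~ w vA].
Hypothesis h7 : prob q [pred w : outcome | [&& w vD, w vS & w vArec != w vA]] = 0.
Hypothesis h8 : prob q [pred w : outcome | [&& w vD, w vS & w vYrec != w vY]] = 0.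
Hypothesis h9 : forall a y d : bool,
  cprob q [pred w : outcome | (w (vYpot a) == y) && (w (vDpot a) == d)]
          [pred w : outcome | w vA == a] =
  cprob q [pred w : outcome | (w vY == y) && (w vD == d)] [pred w : outcome | w vA == a].
Hypothesis h11 : forall a : bool,
  cond_indep q (fun w => (w (vYpot a), w (vDpot a))) (fun w => w vA) predT.

Lemma tested_pos y : 0 < prob q [pred w : outcome | [&& w vD, w vS & w vYrec == y]].
Proof.
case: h1 => h1T h1F.
by case: y; [apply: (lt_le_trans (prob_gt0_cprob h1T))
            | apply: (lt_le_trans (prob_gt0_cprob h1F))]; apply: le_prob; truth_table.
Qed.

Lemma record_mismatch_null :
  prob q [pred w : outcome | [&& w vD, w vS & w vArec != w vA] ||
                             [&& w vD, w vS & w vYrec != w vY]] = 0.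
Proof. exact: prob_or_eq0 h7 h8. Qed.

Lemma tested_delta_pos y :
  0 < prob q [pred w : outcome | w vDelta && [&& w vD, w vS & w vY == y]].
Proof.
have := prob_gt0_cprob (h2 _ (tested_pos y)).
by rewrite (eq_prob_null _ _ [pred w : outcome | w vDelta && [&& w vD, w vS & w vY == y]] h8);
  last truth_table.
Qed.

Lemma tested_odds y :
  muP q y / (1 - muP q y) = odds (fun w => w vA) [pred w : outcome | w vD && (w vY == y)].
Proof.
rewrite /muP cprob_odds -(cond_indep_odds (h4 y)); last first.
  by apply: (lt_le_trans (tested_delta_pos y)); apply: le_prob; truth_table.
rewrite [RHS](eq_odds _ _ [pred w : outcome | [&& w vD, w vS & w vY == y]]); last by truth_table.
rewrite -(cond_indep_odds (h5 y) (tested_delta_pos y)).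
by apply: odds_eq_null record_mismatch_null _ _; truth_table.
Qed.

Lemma exposed_neq0 : prob q (fun w => w vA) != 0.
Proof. by rewrite -(eq_prob [pred w : outcome | w vA == true]) ?lt0r_neq0 //; truth_table. Qed.

Lemma unexposed_neq0 : prob q [pred w : outcome | ~~ w vA] != 0.
Proof. by rewrite -(eq_prob [pred w : outcome | w vA == false]) ?lt0r_neq0 //; truth_table. Qed.

Lemma control_odds :
  odds (fun w => w vA) [pred w : outcome | w vD && (w vY == false)] = odds (fun w => w vA) predT.
Proof.
rewrite (eq_odds _ _ [pred w : outcome | ~~ w vY && w vD]); last by truth_table.
apply: odds_mean_indep exposed_neq0 unexposed_neq0 _ h6.
by apply: (lt_le_trans (tested_delta_pos false)); apply: le_prob; truth_table.
Qed.

Lemma potential_outcome_prob a :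
  prob q [pred w : outcome | w (vYpot a) && w (vDpot a)] =
  cprob q [pred w : outcome | w vY && w vD] [pred w : outcome | w vA == a].
Proof.
rewrite (eq_prob _ [pred w : outcome | (w (vYpot a), w (vDpot a)) == (true, true)]);
  last by truth_table.
rewrite (indep_cprob (true, true) a (h11 a)) ?lt0r_neq0 //.
rewrite (eq_cprob _ [pred w : outcome | (w (vYpot a) == true) && (w (vDpot a) == true)] _
  [pred w : outcome | w vA == a]); try truth_table.
by rewrite h9; apply: eq_cprob; truth_table.
Qed.

Lemma ORP_eq_RRca : ORP q = RRca q.
Proof.
have oddsT_neq0 : odds (fun w => w vA) predT != 0.
  by rewrite odds_predT mulf_neq0 ?invr_eq0 ?exposed_neq0 ?unexposed_neq0.
rewrite /ORP !tested_odds control_odds (odds_cprob _ _ exposed_neq0 unexposed_neq0) mulfK //.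
rewrite /RRca !potential_outcome_prob.
by congr (_ * _^-1); apply: eq_cprob; truth_table.
Qed.

End TestNegativeDesign.
End FiniteProbability.

Theorem theorem2 (R : realType) (r : nat)
  (mu : probability (r.-tuple R) R)
  (q : r.-tuple R -> {ffun outcome -> R})
  (* q x is the conditional law of the binary variables given X = x *)
  (hq_pmf : forall x, is_pmf (q x))
  (hq_meas : forall w, measurable_fun setT (fun x => q x w))
  (* well-definedness of conditioning on A = a given X (used in (6), (9)) *)
  (hApos : {ae mu, forall x, forall a : bool,
             0 < prob (q x) [pred w : outcome | w vA == a]})
  (* (1) *)
  (H1 : {ae mu, forall x,
          0 < cprob (q x) [pred w : outcome | w vYrec && w vD] [pred w : outcome | w vS] /\
          0 < cprob (q x) [pred w : outcome | ~~ w vYrec && w vD] [pred w : outcome | w vS]})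
  (* (2) *)
  (H2 : {ae mu, forall x, forall y : bool,
          0 < prob (q x) [pred w : outcome | [&& w vD, w vS & w vYrec == y]] ->
          0 < cprob (q x) [pred w : outcome | w vDelta]
                          [pred w : outcome | [&& w vD, w vS & w vYrec == y]]})
  (* (3) *)
  (H3 : {ae mu, forall x, forall y : bool,
          0 < prob (q x) [pred w : outcome | w vD && (w vY == y)] ->
          0 < cprob (q x) [pred w : outcome | w vS] [pred w : outcome | w vD && (w vY == y)]})
  (* (4) S indep A | D = 1, Y, X *)
  (H4 : {ae mu, forall x, forall y : bool,
          cond_indep (q x) (fun w => w vS) (fun w => w vA)
                     [pred w : outcome | w vD && (w vY == y)]})
  (* (5) Delta indep A | D = 1, S = 1, Y, X *)
  (H5 : {ae mu, forall x, forall y : bool,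
          cond_indep (q x) (fun w => w vDelta) (fun w => w vA)
                     [pred w : outcome | [&& w vD, w vS & w vY == y]]})
  (* (6) *)
  (H6 : {ae mu, forall x,
          cprob (q x) [pred w : outcome | ~~ w vY && w vD] [pred w : outcome | w vA] =
          cprob (q x) [pred w : outcome | ~~ w vY && w vD] [pred w : outcome | ~~ w vA]})
  (* (7) recorded exposure = A in TND participants *)
  (H7 : {ae mu, forall x,
          prob (q x) [pred w : outcome | [&& w vD, w vS & w vArec != w vA]] = 0})
  (* (8) recorded test result = Y in TND participants *)
  (H8 : {ae mu, forall x,
          prob (q x) [pred w : outcome | [&& w vD, w vS & w vYrec != w vY]] = 0})
  (* (9) consistency *)
  (H9 : {ae mu, forall x, forall a y d : bool,
          cprob (q x) [pred w : outcome | (w (vYpot a) == y) && (w (vDpot a) == d)]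
                      [pred w : outcome | w vA == a] =
          cprob (q x) [pred w : outcome | (w vY == y) && (w vD == d)]
                      [pred w : outcome | w vA == a]})
  (* (10) no interference: built into the single-individual model, see NOTES *)
  (* (11) no unmeasured confounding *)
  (H11 : {ae mu, forall x, forall a : bool,
           cond_indep (q x) (fun w => (w (vYpot a), w (vDpot a)))
                      (fun w => w vA) predT}) :
  {ae mu, forall x, ORP (q x) = RRca (q x)}.
Proof.
near=> x.
by apply: (ORP_eq_RRca _ _ (hq_pmf x)); near: x.
Unshelve. all: by end_near.
Qed.
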